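(* There exists an absolute constant $c>0$ such that for every prime number $p$ and every subset $A\subset\mathbb{F}_p$, $$ |A+A|\,|AA|\ \ge\ c\,\min\Bigl\{\,p|A|,\ \frac{|A|^{4}}{p}\Bigr\}. $$
   Context: $\mathbb{F}_p$ denotes the field of residue classes modulo the prime $p$, and $|X|$ denotes the cardinality of a finite set $X$. For $A\subset\mathbb{F}_p$, the sum set is $A+A=\{a+b:\ a\in A,\ b\in A\}$ and the product set is $AA=\{ab:\ a\in A,\ b\in A\}$. The constant $c$ does not depend on $p$ or $A$ (the paper writes this inequality with the symbol $\gg$). *)

(* Defs.v *)
From HB Require Import structures.
From mathcomp Require Import all_boot all_order all_algebra.
From mathcomp Require Import reals.

Set Implicit Arguments.
Unset Strict Implicit.
Unset Printing Implicit Defensive.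

Import Order.TTheory GRing.Theory Num.Theory.
Local Open Scope ring_scope.

Definition sumset (V : finZmodType) (A B : {set V}) : {set V} :=
  [set a + b | a in A, b in B].

Definition prodset (S : finNzRingType) (A B : {set S}) : {set S} :=
  [set a * b | a in A, b in B].

(* Main.v *)
Require Import Defs.
From HB Require Import structures.
From mathcomp Require Import all_boot all_order all_algebra.
From mathcomp Require Import reals.
From mathcomp Require Import ring lra zify.

(** The proof is a second moment computation for incidences between points
    and lines in the plane over a field with q elements.

    Fix a set S of points.  The q ^ 2 lines y = m x + b are parametrised by
    (m, b).  A point lies on q of them, and two distinct points lie on at most
    one common line, so the number of points of S on a line has mean #|S| / q
    and squared deviations from the mean that add up to at most q * #|S|
    ([variance_incidence]).  Hence, if k is at least twice the mean, at most
    4 q #|S| / k ^ 2 lines contain k points of S ([rich_lines_bound]).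

    Now take S = (A + A) x (AA).  For a, b in A with a != 0, the line
    y = a (x - b) contains the point (b + c, a c) of S for each c in A.  These
    are about #|A| ^ 2 distinct lines, each containing #|A| points of S.  Either
    #|A| is less than twice the mean, which says that #|S| > q * #|A| / 2, or
    the bound on rich lines gives #|A| ^ 4 <= 8 q #|S|. *)

Set Implicit Arguments.
Unset Strict Implicit.
Unset Printing Implicit Defensive.

Import Order.TTheory GRing.Theory Num.Theory.
Local Open Scope ring_scope.

Section Incidence.

Variable F : finFieldType.
Implicit Types (l P Q : F * F) (S L : {set F * F}).

Definition on_line l P := P.2 == l.1 * P.1 + l.2.

Definition incidences S l := #|[set P in S | on_line l P]|.

Lemma card_lines_through P : #|[set l | on_line l P]| = #|F|.
Proof.
have -> : [set l | on_line l P] = [set (m, P.2 - m * P.1) | m : F].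
  apply/setP=> -[m b]; rewrite inE /on_line /=; apply/eqP/imsetP.
    by move=> ->; exists m; rewrite ?inE //; congr (_, _); ring.
  by case=> m' _ [-> ->]; ring.
by rewrite card_imset // => m m' [].
Qed.

Lemma card_lines_through2 P Q :
  P != Q -> (#|[set l | on_line l P & on_line l Q]| <= 1)%N.
Proof.
move=> neqPQ; apply/card_le1_eqP=> -[m b] [m' b'].
rewrite !inE /on_line /= => /andP[/eqP mP /eqP mQ] /andP[/eqP m'P /eqP m'Q].
have neq1 : P.1 - Q.1 != 0.
  apply: contra neqPQ => /eqP/subr0_eq e1.
  by rewrite -pair_eqE /pair_eq e1 eqxx mP mQ e1 /=.
have eqm : m = m'.
  apply: (mulIf neq1); rewrite !mulrBr.
  transitivity (P.2 - Q.2); first by rewrite mP mQ; ring.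
  by rewrite m'P m'Q; ring.
have eqb : b = b' by apply: (addrI (m * P.1)); rewrite -mP m'P eqm.
by rewrite eqm eqb.
Qed.

Lemma incidencesE S l : incidences S l = (\sum_(P in S) on_line l P)%N.
Proof.
rewrite /incidences -sum1_card (eq_bigl (fun P => (P \in S) && on_line l P)).
  by rewrite big_mkcondr; apply: eq_bigr => P _; case: on_line.
by move=> P; rewrite inE.
Qed.

Lemma sum_incidences S : (\sum_l incidences S l = #|S| * #|F|)%N.
Proof.
under eq_bigr do rewrite incidencesE.
rewrite exchange_big /= -sum_nat_const; apply: eq_bigr => P _.
rewrite -(card_lines_through P) -sum1_card [RHS]big_mkcond.
by apply: eq_bigr => l _; rewrite inE; case: on_line.
Qed.

(** The left-hand side counts triples (l, P, Q) with P and Q both on l; it is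
    summed over the pairs (P, Q) first. *)
Lemma sum_sqr_incidences S :
  (\sum_l incidences S l ^ 2 <= #|S| ^ 2 + #|S| * #|F|)%N.
Proof.
have -> : (\sum_l incidences S l ^ 2 =
    \sum_(P in S) \sum_(Q in S) #|[set l | on_line l P & on_line l Q]|)%N.
  transitivity (\sum_l \sum_(P in S) \sum_(Q in S)
      (on_line l P && on_line l Q))%N.
    apply: eq_bigr => l _; rewrite incidencesE -mulnn big_distrl /=.
    apply: eq_bigr => P _; rewrite big_distrr /=.
    by apply: eq_bigr => Q _; rewrite mulnb.
  rewrite exchange_big /=; apply: eq_bigr => P _.
  rewrite exchange_big /=; apply: eq_bigr => Q _.
  rewrite -sum1_card [RHS]big_mkcond.
  by apply: eq_bigr => l _; rewrite inE; case: (_ && _).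
have -> : (#|S| ^ 2 + #|S| * #|F| = \sum_(P in S) (#|S| + #|F|))%N.
  by rewrite sum_nat_const mulnDr mulnn.
apply: leq_sum => P SP.
rewrite (bigD1 P) //= addnC; apply: leq_add.
  rewrite -[leqRHS]muln1 -sum_nat_const [leqRHS](bigD1 P) //=.
  apply: leq_trans (leq_addl _ _); apply: leq_sum => Q /andP[_ neqQP].
  by apply: card_lines_through2; rewrite eq_sym.
rewrite -(card_lines_through P); apply: subset_leq_card.
by apply/subsetP=> l; rewrite !inE => /andP[].
Qed.

Variable R : realFieldType.

Let q : R := #|F|%:R.

Let q_gt0 : 0 < q.
Proof. by rewrite ltr0n; apply/card_gt0P; exists 0. Qed.

Lemma variance_incidence S :
  \sum_l ((incidences S l)%:R - #|S|%:R / q) ^+ 2 <= q * #|S|%:R :> R.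
Proof.
have q_neq0 : q != 0 by rewrite gt_eqF.
set s : R := #|S|%:R.
have sum1 : \sum_l (incidences S l)%:R = s * q.
  by rewrite -natr_sum sum_incidences natrM.
have sum2 : \sum_l (incidences S l)%:R ^+ 2 <= s ^+ 2 + s * q.
  rewrite /s /q -natrX -natrM -natrD.
  under eq_bigr do rewrite -natrX.
  by rewrite -natr_sum ler_nat sum_sqr_incidences.
under eq_bigr do rewrite sqrrB.
rewrite big_split sumrB /= sumr_const card_prod sumrMnl -mulr_suml sum1.
rewrite -[X in _ + X <= _]mulr_natr natrM -/q.
have -> : s * q * (s / q) *+ 2 = 2 * s ^+ 2 by field.
have -> : (s / q) ^+ 2 * (q * q) = s ^+ 2 by field.
lra.
Qed.

(** Chebyshev's inequality: when k is at least twice the mean #|S| / q, every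
    line of L contributes at least (k / 2) ^ 2 to the variance. *)
Lemma rich_lines_bound S L (k : nat) :
  (forall l, l \in L -> (k <= incidences S l)%N) ->
  2 * #|S|%:R <= q * k%:R ->
  #|L|%:R * k%:R ^+ 2 <= 4 * q * #|S|%:R :> R.
Proof.
move=> richL le_mean; pose mu : R := #|S|%:R / q.
have mu_le : 2 * mu <= k%:R.
  by rewrite /mu mulrA ler_pdivrMr // [leRHS]mulrC.
have mu_ge0 : 0 <= mu by rewrite divr_ge0 ?ler0n ?ltW.
have : \sum_(l in L) (k%:R / 2) ^+ 2 <= q * #|S|%:R.
  apply: le_trans (variance_incidence S).
  rewrite [leLHS]big_mkcond /=; apply: ler_sum => l _.
  case: ifP => [/richL|_]; last exact: sqr_ge0.
  rewrite -(ler_nat R) -/mu => le_k; rewrite ler_sqr ?nnegrE; lra.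
rewrite sumr_const -mulr_natl; lra.
Qed.

End Incidence.

Section SumProduct.

Variable F : finFieldType.
Implicit Types A : {set F}.

Lemma incidences_sum_prod A (a b : F) : a \in A -> b \in A ->
  (#|A| <= incidences (setX (sumset A A) (prodset A A)) (a, - (a * b)))%N.
Proof.
move=> Aa Ab; pose point c := (b + c, a * c).
rewrite -(@card_imset _ _ point); last by move=> c c' [/addrI].
apply/subset_leq_card/subsetP=> _ /imsetP[c Ac ->].
rewrite !inE /on_line /= !imset2_f //=.
by apply/eqP; ring.
Qed.

Lemma sum_prod_dichotomy (R : realFieldType) A : (1 < #|A|)%N ->
  let s : R := #|sumset A A|%:R * #|prodset A A|%:R in
  #|F|%:R * #|A|%:R <= 2 * s \/ #|A|%:R ^+ 4 <= 8 * #|F|%:R * s.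
Proof.
move=> A_gt1 s.
pose L := [set (x.1, - (x.1 * x.2)) | x in setX (A :\ 0) A].
have cardL : #|L| = (#|A :\ 0%R| * #|A|)%N.
  rewrite card_in_imset ?cardsX // => -[a b] [a' b'].
  rewrite !inE /= => /andP[/andP[a_neq0 _] _] _ [<- /oppr_inj].
  by move/(mulfI a_neq0) ->.
have leL : (#|A| ^ 2 <= 2 * #|L|)%N.
  rewrite cardL mulnA -mulnn leq_mul2r; apply/orP; right.
  move: A_gt1 (cardsD1 (0 : F) A); case: (_ \in _) => /=;
    move: #|A| #|A :\ 0%R| => n m; lia.
have [le_mean|/ltW] := leP (2 * s) (#|F|%:R * #|A|%:R); last by left.
right; have := @rich_lines_bound F R (setX (sumset A A) (prodset A A)) L #|A|.
rewrite cardsX natrM -/s => /(_ _ le_mean) rich.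
have {rich}/rich : forall l, l \in L ->
    (#|A| <= incidences (setX (sumset A A) (prodset A A)) l)%N.
  move=> _ /imsetP[[a b] + ->]; rewrite !inE /= => /andP[/andP[_ Aa] Ab].
  exact: incidences_sum_prod.
move: leL; rewrite -(ler_nat R) natrM natrX => leL rich.
have := ler_wpM2r (sqr_ge0 (#|A|%:R : R)) leL.
rewrite -exprD; lra.
Qed.

(** The lines used above have nonzero slope in A, so A = {0} provides none;
    sets with at most one element are compared directly. *)
Lemma sum_prod_bound (R : realFieldType) A :
  8^-1 * Num.min (#|F|%:R * #|A|%:R) (#|A|%:R ^+ 4 / #|F|%:R)
    <= #|sumset A A|%:R * #|prodset A A|%:R :> R.
Proof.
have q_ge1 : 1 <= #|F|%:R :> R by rewrite ler1n; apply/card_gt0P; exists 0.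
have q_gt0 : 0 < #|F|%:R :> R := lt_le_trans ltr01 q_ge1.
have s_ge0 : 0 <= #|sumset A A|%:R * #|prodset A A|%:R :> R.
  by rewrite mulr_ge0.
have [A_gt1|A_le1] := ltnP 1 #|A|.
  have [le1|le2] := sum_prod_dichotomy R A_gt1.
    rewrite mulrC ler_pdivrMr ?ltr0n // ge_min; apply/orP; left; lra.
  rewrite mulrC ler_pdivrMr ?ltr0n // ge_min; apply/orP; right.
  rewrite ler_pdivrMr //; lra.
have [->|[a Aa]] := set_0Vmem A.
  rewrite cards0 mulr0 expr0n mul0r minxx mulr0.
  by rewrite mulr_ge0.
have s_ge1 : 1 <= #|sumset A A|%:R * #|prodset A A|%:R :> R.
  rewrite -natrM ler1n muln_gt0; apply/andP; split; apply/card_gt0P.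
    by exists (a + a); apply: imset2_f.
  by exists (a * a); apply: imset2_f.
have A_1 : #|A| = 1%N.
  by apply/eqP; rewrite eqn_leq A_le1; apply/card_gt0P; exists a.
rewrite A_1 expr1n mulrC ler_pdivrMr ?ltr0n // ge_min; apply/orP; right.
rewrite ler_pdivrMr //; nra.
Qed.

End SumProduct.

Theorem theorem1 (R : realType) :
  exists c : R, 0 < c /\
    forall p : nat, prime p -> forall A : {set 'F_p},
      c * Num.min (p%:R * #|A|%:R) (#|A|%:R ^+ 4 / p%:R)
        <= #|sumset A A|%:R * #|prodset A A|%:R.
Proof.
exists 8^-1; split=> [|p p_prime A]; first by rewrite invr_gt0 ltr0n.
by have := sum_prod_bound R A; rewrite card_Fp.
Qed.
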